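(* Let $\alpha,\kappa\ge0$ and $\mathcal{U}=\{(h,b)^\top\in\mathbb{R}^2: h\ge0,\ b\ge 0\}$. For any given left state $(h_-,b_-)^\top\in\mathcal{U}$ and right state $(h_+,b_+)^\top\in\mathcal{U}$ such that at most one of the four numbers $h_-,h_+,b_-,b_+$ is zero, the Riemann problem $$h_t+\left(\alpha h^2b+\frac{\kappa h^3}{3}\right)_x=0,\qquad b_t+\left(\alpha hb^2+\frac{\kappa h^2b}{3}\right)_x=0,$$ $$(h,b)(x,0)=(h_-,b_-)\ \text{ if } x<0,\qquad (h,b)(x,0)=(h_+,b_+)\ \text{ if } x>0,$$ admits a unique solution in $\mathcal{U}$.
   Context: Notion of solution. Put $\lambda_1(h,b)=\alpha hb+\frac{\kappa h^2}{3}$ and $\lambda_2(h,b)=3\lambda_1(h,b)$ (the eigenvalues of the flux Jacobian), and let $[\![v]\!]=v_r-v_l$ denote the jump (right value minus left value). Solutions of the Riemann problem are self-similar and consist of finitely many constant states in $\mathcal{U}$ separated by waves of the following kinds, arranged from left to right in order of nondecreasing speed (adjacent waves may be attached to each other without a constant state of positive width in between, forming a composite wave): (i) contact discontinuity $J$ between $U_l$ and $U_r$, moving with speed $\lambda_1(U_l)=\lambda_1(U_r)$; (ii) shock wave $S$ between $U_l=(h_l,b_l)$ and $U_r=(h_r,b_r)$, moving with speed $\sigma$, satisfying the Rankine–Hugoniot conditions $\sigma[\![h]\!]=[\![h\lambda_1(h,b)]\!]$, $\sigma[\![b]\!]=[\![b\lambda_1(h,b)]\!]$ and the Lax entropy conditions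 $\lambda_2(U_r)<\sigma<\lambda_2(U_l)$, $\lambda_1(U_l)<\sigma$ (in the interior of $\mathcal{U}$ this means $b_r/h_r=b_l/h_l$, $h_r<h_l$, $b_r<b_l$); (iii) rarefaction wave $R$: a continuous fan in which $\lambda_2(h,b)=x/t$ and $(h,b)$ stays on a ray $b/h=\text{const}$, with $h$ and $b$ nondecreasing from left to right; (iv) delta shock $\delta S$ (occurring when $h_+=0$): $h$ is $h_-$ for $x<\sigma_\delta t$ and $0$ for $x>\sigma_\delta t$, while $b$ is, at each time $t$, the measure equal to $b_-$ for $x<\sigma_\delta t$, $b_+$ for $x>\sigma_\delta t$, plus the Dirac mass $\beta(t)\delta(x-\sigma_\delta t)$ with $\beta(0)=0$. It is required to satisfy the generalized Rankine–Hugoniot conditions $\sigma_\delta[\![h]\!]=[\![h\lambda_1(h,b)]\!]$, $\frac{d\beta}{dt}=\sigma_\delta[\![b]\!]-[\![b\lambda_1(h,b)]\!]$, and the overcompressibility (generalized entropy) condition $0=\lambda_1(h_+,b_+)<\sigma_\delta=\lambda_1(h_-,b_-)<\lambda_2(h_-,b_-)$. Uniqueness is understood within this class of solutions.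
   Formalization: The case κ = 0, α > 0, b₊ = 0 is excluded: there λ₁(U₋) > 0 = λ₁(U₊) with h₊ > 0, and no admissible sequence of waves (i)–(iv) joins the two states (e.g. α = 1, U₋ = (1,1), U₊ = (1,0)), so no solution exists. *)

(* Defs.v *)
From HB Require Import structures.
From mathcomp Require Import all_boot all_order all_algebra.
From mathcomp Require Import all_classical all_reals all_analysis.
From mathcomp Require Import ring lra.
Set Implicit Arguments.
Unset Strict Implicit.
Unset Printing Implicit Defensive.
Import Order.TTheory GRing.Theory Num.Theory.
Import numFieldNormedType.Exports.
Local Open Scope classical_set_scope.
Local Open Scope ring_scope.

(* A state U = (h, b) is a pair: h = U.1, b = U.2. *)

Definition admissible_state (R : realType) (U : R * R) : Prop :=
  0 <= U.1 /\ 0 <= U.2.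

Definition lambda1 (R : realType) (alpha kappa : R) (U : R * R) : R :=
  alpha * U.1 * U.2 + kappa * U.1 ^+ 2 / 3.

Definition lambda2 (R : realType) (alpha kappa : R) (U : R * R) : R :=
  3 * lambda1 alpha kappa U.

Definition flux_h (R : realType) (alpha kappa : R) (U : R * R) : R :=
  U.1 * lambda1 alpha kappa U.

Definition flux_b (R : realType) (alpha kappa : R) (U : R * R) : R :=
  U.2 * lambda1 alpha kappa U.

Lemma flux_hE (R : realType) (alpha kappa h b : R) :
  flux_h alpha kappa (h, b) = alpha * h ^+ 2 * b + kappa * h ^+ 3 / 3.
Proof. by rewrite /flux_h /lambda1 /=; field. Qed.

Lemma flux_bE (R : realType) (alpha kappa h b : R) :
  flux_b alpha kappa (h, b) = alpha * h * b ^+ 2 + kappa * h ^+ 2 * b / 3.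
Proof. by rewrite /flux_b /lambda1 /=; field. Qed.

(* A wave stores its speed(s): [Rarefaction s e f] is the fan (h, b) = f (x / t)
   in s * t <= x <= e * t; [DeltaShock s beta] carries, at time t, the point
   mass [beta t] located at x = s * t in the b-component. *)
Inductive wave (R : realType) : Type :=
| Contact of R
| Shock of R
| Rarefaction of R & R & (R -> R * R)
| DeltaShock of R & (R -> R).

Definition wave_head (R : realType) (w : wave R) : R :=
  match w with
  | Contact s | Shock s | Rarefaction s _ _ | DeltaShock s _ => s
  end.

Definition wave_tail (R : realType) (w : wave R) : R :=
  match w with
  | Contact s | Shock s | Rarefaction _ s _ | DeltaShock s _ => s
  end.

Definition is_contact (R : realType) (alpha kappa : R) (Ul Ur : R * R) (s : R)
  : Prop :=
  s = lambda1 alpha kappa Ul /\ s = lambda1 alpha kappa Ur.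

Definition is_shock (R : realType) (alpha kappa : R) (Ul Ur : R * R) (s : R)
  : Prop :=
  [/\ s * (Ur.1 - Ul.1) = flux_h alpha kappa Ur - flux_h alpha kappa Ul,
      s * (Ur.2 - Ul.2) = flux_b alpha kappa Ur - flux_b alpha kappa Ul,
      lambda2 alpha kappa Ur < s < lambda2 alpha kappa Ul
    & lambda1 alpha kappa Ul < s].

(* The ray b / h = c is written b = c * h, so that a fan may start at the
   vacuum state (0, 0). *)
Definition is_rarefaction (R : realType) (alpha kappa : R) (Ul Ur : R * R)
    (s e : R) (f : R -> R * R) : Prop :=
  [/\ s = lambda2 alpha kappa Ul, e = lambda2 alpha kappa Ur & s < e] /\
  [/\ f s = Ul, f e = Ur & {within `[s, e], continuous f}] /\
  [/\ forall xi, s <= xi <= e -> admissible_state (f xi),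
      forall xi, s <= xi <= e -> lambda2 alpha kappa (f xi) = xi,
      exists c : R, forall xi, s <= xi <= e -> (f xi).2 = c * (f xi).1
    & forall xi1 xi2, s <= xi1 -> xi1 <= xi2 -> xi2 <= e ->
        (f xi1).1 <= (f xi2).1 /\ (f xi1).2 <= (f xi2).2].

Definition is_delta_shock (R : realType) (alpha kappa : R) (Ul Ur : R * R)
    (s : R) (beta : R -> R) : Prop :=
  Ur.1 = 0 /\
  s * (Ur.1 - Ul.1) = flux_h alpha kappa Ur - flux_h alpha kappa Ul /\
  [/\ beta 0 = 0,
      {within `[0, +oo[, continuous beta}
    & forall t : R, 0 < t -> is_derive t 1 beta
        (s * (Ur.2 - Ul.2) - (flux_b alpha kappa Ur - flux_b alpha kappa Ul))]
  /\
  [/\ 0 = lambda1 alpha kappa Ur, lambda1 alpha kappa Ur < s,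
      s = lambda1 alpha kappa Ul
    & lambda1 alpha kappa Ul < lambda2 alpha kappa Ul].

Definition wave_between (R : realType) (alpha kappa : R) (Ul : R * R)
    (w : wave R) (Ur : R * R) : Prop :=
  match w with
  | Contact s => is_contact alpha kappa Ul Ur s
  | Shock s => is_shock alpha kappa Ul Ur s
  | Rarefaction s e f => is_rarefaction alpha kappa Ul Ur s e f
  | DeltaShock s beta => is_delta_shock alpha kappa Ul Ur s beta
  end.

(* A wave pattern issued from U is a list [:: (w1, U1); ...; (wn, Un)]: the wave
   wi separates the constant states U(i-1) and Ui, where U0 = U. *)
Fixpoint wave_pattern (R : realType) (alpha kappa : R) (Ul : R * R)
    (ws : seq (wave R * (R * R))) (Ur : R * R) : Prop :=
  match ws with
  | [::] => Ul = Ur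
  | (w, Um) :: ws' =>
      [/\ wave_between alpha kappa Ul w Um, admissible_state Um
        & wave_pattern alpha kappa Um ws' Ur]
  end.

(* Equality of consecutive speeds is allowed: this is a composite wave. *)
Definition ordered_speeds (R : realType) (ws : seq (wave R * (R * R))) : bool :=
  sorted (fun p q => wave_tail p.1 <= wave_head q.1) ws.

(* The value (h, b)(t, x) of the regular part of a pattern. At t = 0 this is the
   leftmost state for x < 0 and the rightmost one for x > 0. The value on the
   discontinuity lines is a convention, irrelevant almost everywhere. *)
Fixpoint profile (R : realType) (U : R * R) (ws : seq (wave R * (R * R)))
    (t x : R) : R * R :=
  match ws with
  | [::] => U
  | (w, V) :: ws' =>
      if x < wave_head w * t then U else
      match w with
      | Rarefaction _ e f =>
          if x < e * t then f (x / t) else profile V ws' t x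
      | _ => profile V ws' t x
      end
  end.

Definition singular_part (R : realType) (w : wave R) (t : R) (A : set R)
  : \bar R :=
  match w with
  | DeltaShock s beta => ((beta t)%:E * dirac (s * t)%R A)%E
  | _ => 0%E
  end.

(* h is a function of (t, x); b is a measure in x depending on the time t. *)
Definition riemann_solution (R : realType) (alpha kappa : R) (Um Up : R * R)
    (h : R -> R -> R) (b : R -> {measure set (measurableTypeR R) -> \bar R})
  : Prop :=
  exists ws : seq (wave R * (R * R)),
    [/\ wave_pattern alpha kappa Um ws Up,
        ordered_speeds ws,
        forall t, 0 <= t ->
          {ae @lebesgue_measure R, forall x, h t x = (profile Um ws t x).1}
      & forall t, 0 <= t -> forall A : set R, measurable A ->
          b t A = (\int[@lebesgue_measure R]_(x in A)
                     ((profile Um ws t x).2)%:E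
                   + \sum_(p <- ws) singular_part p.1 t A)%E].

Definition same_solution (R : realType)
    (h1 : R -> R -> R) (b1 : R -> {measure set (measurableTypeR R) -> \bar R})
    (h2 : R -> R -> R) (b2 : R -> {measure set (measurableTypeR R) -> \bar R})
  : Prop :=
  forall t, 0 <= t ->
    {ae @lebesgue_measure R, forall x, h1 t x = h2 t x} /\
    (forall A : set R, measurable A -> b1 t A = b2 t A).

(* Main.v *)
Require Import Defs.
From HB Require Import structures.
From mathcomp Require Import all_boot all_order all_algebra.
From mathcomp Require Import all_classical all_reals all_analysis.
From mathcomp Require Import measurable_realfun.
From mathcomp Require Import ring lra.
Import Order.TTheory GRing.Theory Num.Theory.
Import numFieldNormedType.Exports.
Local Open Scope classical_set_scope.
Local Open Scope ring_scope.

(** Write U for the left state, V for the right state, and lam for lambda1. The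
    flux is (h, b) |-> lam (h, b) * (h, b) with lam homogeneous of degree two,
    so every wave but a delta shock keeps either lam or the ray through the
    origin: contacts have equal lam on both sides and speed lam; the jump
    conditions of a Lax shock say that (s - lam) * (h, b) is the same on both
    sides, so the two states are proportional; rarefactions follow a ray by
    definition.

    Speeds fix the order of the waves. No wave issued from a state W has a head
    faster than lambda2 W = 3 * lam W ([wave_head_le]), whereas a shock with W
    on its right is strictly faster than that, and so is a delta shock, after
    which lambda2 W = 0. Hence nothing follows a shock or a delta shock
    ([no_wave_right_of_fast_front]). A rarefaction into W ends exactly at 3 *
    lam W > 0, so only a further rarefaction, on the same ray, can follow it
    ([pattern_right_of_rarefaction]). Every pattern thus consists of contacts,
    all at speed lam U, followed by at most one wave up to subdivision of a fan.

    If lam V > 0, the state reached by the contacts lies on the ray of V and has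
    eigenvalue lam U. There is exactly one such state, [ray_state (lam U) V],
    and the sign of lam V - lam U decides between a shock and a fan, inside
    which the state is [ray_state (x / t / 3) V]. If lam V = 0, no shock or
    rarefaction can end at V, so that either lam U = 0 and contacts suffice, or
    there is one delta shock. Contacts may precede it at the same speed and
    change the state on its left, but the mass it carries grows at a rate that
    depends on lam U and on the b-component of V only.

    Both cases are covered by the explicit function [riemann_profile] and the
    rate [delta_mass]: [pattern_profile] shows by induction on the list of waves
    that every pattern from U to V has this profile, at every point, and this
    singular part. Uniqueness follows at once. For existence it remains to
    exhibit one pattern ([riemann_pattern]), and to realize b as a measure, the
    sum of a density and a Dirac mass. *)

(** * Measures with a density *)

Lemma density_measure {R : realType} {d : measure_display}
    {T : measurableType d} (mu : {measure set T -> \bar R}) {f : T -> R} :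
  measurable_fun setT f -> (forall x, 0 <= f x) ->
  exists m : {measure set T -> \bar R}, forall A : set T,
    measurable A -> m A = (\int[mu]_(x in A) (f x)%:E)%E.
Proof.
move=> mf f0.
pose m (A : set T) := (\int[mu]_(x in A) (f x)%:E)%E.
have /measurable_EFinP mfE := mf.
have m0 : m set0 = 0%E by exact: integral_set0.
have m_ge0 A : (0 <= m A)%E by apply: integral_ge0 => x _; rewrite lee_fin.
have m_additive : semi_sigma_additive m.
  move=> /= F mF tF mUF; rewrite /m ge0_integral_bigcup//=.
  - by apply: is_cvg_ereal_nneg_natsum_cond => n _ _; exact: m_ge0.
  - exact: (measurable_funTS mfE).
  - by move=> x _; rewrite lee_fin.
pose mM := isMeasure.Build _ _ _ m m0 m_ge0 m_additive.
pose mm : {measure set T -> \bar R} := HB.pack m mM.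
by exists mm.
Qed.

Section RiemannProblem.
Context {R : realType} (alpha kappa : R).
Hypotheses (alpha_ge0 : 0 <= alpha) (kappa_ge0 : 0 <= kappa).
Local Notation lam := (lambda1 alpha kappa).

(** * Rays and the eigenvalue *)

Definition dilate (k : R) (U : R * R) : R * R := (k * U.1, k * U.2).

(** The state with eigenvalue l on the ray through V, where lam grows like the
    square of the dilation factor. It is meaningful for lam V > 0; when
    lam V = 0 the division by zero makes it the origin. *)
Definition ray_state (l : R) (V : R * R) : R * R :=
  dilate (Num.sqrt (l / lam V)) V.

Lemma lambda1_ge0 {U : R * R} : admissible_state U -> 0 <= lam U.
Proof. by move=> [h0 b0]; rewrite /lambda1 addr_ge0 ?mulr_ge0. Qed.

(** Away from h = 0, a zero eigenvalue means a degenerate flux: either lam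
    vanishes identically, or lam is alpha * h * b and b = 0. *)
Lemma lambda1_eq0 {U : R * R} : admissible_state U -> U.1 != 0 -> lam U = 0 ->
  kappa = 0 /\ (alpha = 0 \/ U.2 = 0).
Proof.
move=> [h0 b0] hn0 /eqP; rewrite /lambda1 paddr_eq0 ?mulr_ge0//.
rewrite !(mulf_eq0, invr_eq0, pnatr_eq0, negbTE hn0, orbF).
by case/andP=> /orP ab /eqP k0; split=> //; case: ab => /eqP; [left|right].
Qed.

Lemma lambda1_dilate (k : R) (U : R * R) : lam (dilate k U) = k ^+ 2 * lam U.
Proof. by rewrite /lambda1 /dilate /=; field. Qed.

Lemma dilate_admissible (k : R) (U : R * R) :
  0 <= k -> admissible_state U -> admissible_state (dilate k U).
Proof. by move=> k0 [h0 b0]; split; rewrite mulr_ge0. Qed.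

(** A ray does not depend on the state that represents it, which allows V to be
    replaced by any other state met along a shock or a fan. *)
Lemma ray_state_dilate (l m : R) (V : R * R) :
  0 < m -> ray_state l (dilate m V) = ray_state l V.
Proof.
move=> m0; rewrite /ray_state lambda1_dilate invfM mulrCA.
rewrite sqrtrM ?invr_ge0 ?exprn_ge0 ?ltW// sqrtrV ?exprn_ge0 ?ltW//.
rewrite sqrtr_sqr gtr0_norm// /dilate /=.
by congr pair; field; rewrite gt_eqF.
Qed.

Lemma ray_state_self (V : R * R) : 0 < lam V -> ray_state (lam V) V = V.
Proof.
move=> V0; rewrite /ray_state divff ?gt_eqF// sqrtr1 /dilate !mul1r.
by case: V V0.
Qed.

Lemma lambda1_gt0_ray (V : R * R) (c : R) :
  admissible_state V -> V.2 = c * V.1 -> 0 < lam V -> 0 < V.1.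
Proof.
move=> [h0 _] Vc; rewrite [0 < V.1]lt_neqAle h0 andbT eq_sym /lambda1 Vc.
by apply: contraTneq => ->; rewrite !(mulr0, mul0r, expr0n) addr0 ltxx.
Qed.

Lemma same_ray_dilate {U V : R * R} {c : R} : U.2 = c * U.1 -> V.2 = c * V.1 ->
  V.1 != 0 -> U = dilate (U.1 / V.1) V.
Proof.
case: U V => [h b] [h' b'] /= -> -> h'0; rewrite /dilate /=.
by congr pair; field.
Qed.

(** The eigenvalue is an injective coordinate on the admissible part of a ray,
    unless it vanishes identically there. The ray is given as b = c * h, so that
    U may be the origin. *)
Lemma same_ray_state (U V : R * R) (c : R) :
  admissible_state U -> admissible_state V ->
  U.2 = c * U.1 -> V.2 = c * V.1 -> 0 < lam V -> ray_state (lam U) V = U.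
Proof.
move=> aU aV Uc Vc V0; have h0 := lambda1_gt0_ray _ _ aV Vc V0.
have k0 : 0 <= U.1 / V.1 by apply: divr_ge0; [case: aU|exact: ltW].
have {Uc} -> := same_ray_dilate Uc Vc (lt0r_neq0 h0).
case: (U) k0 => u1 u2 /= k0; move: (u1 / _) k0 => k k0.
by rewrite /ray_state lambda1_dilate mulfK ?gt_eqF// sqrtr_sqr ger0_norm.
Qed.

(** * Shocks and rarefactions stay on a ray *)

(** The jump conditions read (s - lam V) * V = (s - lam U) * U, and both factors
    are positive by the Lax conditions. The ratio k is less than 1 because
    lam V = k ^+ 2 * lam U is less than lam U. *)
Lemma shock_dilate {U V : R * R} {s : R} :
  admissible_state U -> admissible_state V -> is_shock alpha kappa U V s ->
  exists k, [/\ 0 < k < 1, V = dilate k U, 0 < lam U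
    & s = (1 + k + k ^+ 2) * lam U].
Proof.
move=> aU aV [rh rb /andP[Vs sU] Us].
have := lambda1_ge0 aU; have := lambda1_ge0 aV => V0 U0.
move: Vs sU rh rb; rewrite /lambda2 /flux_h /flux_b => Vs sU rh rb.
have sV : 0 < s - lam V by lra.
have k0 : 0 < (s - lam U) / (s - lam V).
  by apply: divr_gt0; rewrite ?subr_gt0// -subr_gt0.
set k := _ / _ in k0.
have kE : k * (s - lam V) = s - lam U by rewrite divfK ?gt_eqF.
have VE : V = dilate k U.
  have sV0 := lt0r_neq0 sV.
  have V1 : V.1 = k * U.1 by apply: (mulIf sV0); rewrite mulrAC kE; lra.
  have V2 : V.2 = k * U.2 by apply: (mulIf sV0); rewrite mulrAC kE; lra.
  by rewrite /dilate -V1 -V2; case: (V).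
have lV : lam V = k ^+ 2 * lam U by rewrite VE lambda1_dilate.
have lU : 0 < lam U by lra.
have k1 : k < 1.
  have : k ^+ 2 * lam U < 1 * lam U by rewrite mul1r -lV; lra.
  by rewrite ltr_pM2r// expr_lt1// ltW.
exists k; split => //; first by rewrite k0 k1.
rewrite lV in kE.
(* kE rearranges to (1 - k) * s = (1 - k ^+ 3) * lam U. *)
have k1' : 1 - k != 0 by apply: lt0r_neq0; rewrite subr_gt0.
by apply: (mulfI k1'); lra.
Qed.

Lemma rarefaction_gt0 {U V : R * R} {s e : R} {f : R -> R * R} :
  admissible_state U -> is_rarefaction alpha kappa U V s e f ->
  lam U < lam V /\ 0 < lam V.
Proof.
by move=> /lambda1_ge0 U0 [[-> ->] + _]; rewrite /lambda2 => ?; split; lra.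
Qed.

(** lambda2 = 3 * lam equals xi inside the fan, and the end state V, having a
    positive eigenvalue, determines the ray. *)
Lemma rarefaction_fan {U V : R * R} {s e : R} {f : R -> R * R} :
  admissible_state U -> admissible_state V ->
  is_rarefaction alpha kappa U V s e f ->
  forall xi, s <= xi <= e -> f xi = ray_state (xi / 3) V.
Proof.
move=> aU aV rar xi xise; have [_ V0] := rarefaction_gt0 aU rar.
case: rar => [[sE eE se] [[fs fe _] [fa fl [c fc] _]]].
have ee : s <= e <= e by rewrite lexx ltW.
have -> : xi / 3 = lam (f xi) by rewrite -{1}(fl _ xise) /lambda2; field.
apply/esym/(same_ray_state _ _ c) => //; [exact: fa|exact: fc|].
by rewrite -fe; exact: fc.
Qed.

Lemma rarefaction_start {U V : R * R} {s e : R} {f : R -> R * R} :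
  admissible_state U -> admissible_state V ->
  is_rarefaction alpha kappa U V s e f -> ray_state (lam U) V = U.
Proof.
move=> aU aV rar; have := rarefaction_fan aU aV rar s.
case: rar => [[sE eE se] [[-> fe _] _]] UE; rewrite [RHS]UE ?lexx ?ltW//.
by congr ray_state; rewrite sE /lambda2; field.
Qed.

Lemma rarefaction_dilate {U V : R * R} {s e : R} {f : R -> R * R} :
  admissible_state U -> admissible_state V -> 0 < lam U ->
  is_rarefaction alpha kappa U V s e f -> exists2 m, 1 <= m & V = dilate m U.
Proof.
move=> aU aV U0 rar; have UE := rarefaction_start aU aV rar.
have [UV V0] := rarefaction_gt0 aU rar.
set k := Num.sqrt (lam U / lam V).
have k0 : 0 < k by rewrite sqrtr_gt0 divr_gt0.
exists k^-1.
  rewrite invf_ge1// -sqrtr1 ler_sqrt// ler_pdivrMr// mul1r; exact: ltW.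
by rewrite -UE /ray_state -/k /dilate /= !mulKf ?gt_eqF//; case: (V).
Qed.

(** * The candidate solution *)

(** The jump conditions between V and k * V give the speed
    (1 + k + k ^+ 2) * lam V, where l = k ^+ 2 * lam V. *)
Definition shock_speed (l : R) (V : R * R) : R :=
  l + Num.sqrt (l * lam V) + lam V.

(** The solution to the right of a contact of speed l. The case lam V = 0 needs
    no separate clause: for t >= 0 and x >= l * t, all the tests on x fail (when
    l > 0, because the shock speed is then l itself) and the value is V. *)
Definition right_profile (l : R) (V : R * R) (t x : R) : R * R :=
  if lam V < l then
    if x < shock_speed l V * t then ray_state l V else V
  else if x < 3 * l * t then ray_state l V
  else if x < 3 * lam V * t then ray_state (x / t / 3) V else V.

Definition riemann_profile (U V : R * R) (t x : R) : R * R :=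
  if x < lam U * t then U else right_profile (lam U) V t x.

Definition delta_mass (U V : R * R) : R :=
  if lam V == 0 then lam U * V.2 else 0.

(** * Which waves can follow each other *)

Lemma wave_head_le {U V : R * R} {w : wave R} :
  admissible_state U -> wave_between alpha kappa U w V ->
  wave_head w <= lambda2 alpha kappa U.
Proof.
move=> aU; have := lambda1_ge0 aU.
rewrite /lambda2; case: w => [s|s|s e f|s be] U0 /=.
- by case=> ->; lra.
- by case=> _ _ /andP[_ /ltW].
- by case=> [[->]].
- by case=> [_ [_ [_ [_ _ -> _]]]]; lra.
Qed.

(** This applies to shocks by the Lax condition, and to delta shocks because the
    state on their right has eigenvalue 0. *)
Lemma no_wave_right_of_fast_front {w : wave R} {U V : R * R}
    {ws : seq (wave R * (R * R))} :
  admissible_state U -> lambda2 alpha kappa U < wave_tail w ->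
  wave_pattern alpha kappa U ws V -> ordered_speeds ((w, U) :: ws) -> ws = [::].
Proof.
move=> aU fast; case: ws => [//|[w' U'] ws] /= [ww' _ _] /andP[ww _].
by have := wave_head_le aU ww'; rewrite leNgt (lt_le_trans fast).
Qed.

(** From a state with eigenvalue lam U > 0, contacts and delta shocks travel at
    lam U and shocks strictly slower than 3 * lam U; only a fan starts as fast
    as the previous one ends. *)
Lemma wave_right_of_rarefaction {w w' : wave R} {U V : R * R} :
  0 < lam U -> wave_tail w = lambda2 alpha kappa U ->
  wave_between alpha kappa U w' V -> wave_tail w <= wave_head w' ->
  exists s e f, w' = Rarefaction s e f.
Proof.
rewrite /lambda2 => U0 ->; case: w' => [s|s|s e f|s be] /=.
- by case=> -> _; lra.
- by case=> _ _ /andP[_]; rewrite /lambda2; lra.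
- by exists s, e, f.
- by case=> [_ [_ [_ [_ _ -> _]]]]; lra.
Qed.

(** All the states to the right of a fan lie on its ray, by
    [wave_right_of_rarefaction] applied along the list. *)
Lemma pattern_right_of_rarefaction {w : wave R} {U V : R * R}
    {ws : seq (wave R * (R * R))} :
  admissible_state U -> 0 < lam U -> wave_tail w = lambda2 alpha kappa U ->
  wave_pattern alpha kappa U ws V -> ordered_speeds ((w, U) :: ws) ->
  exists2 m, 1 <= m & V = dilate m U.
Proof.
elim: ws w U => [|[w' U'] ws IH] w U aU U0 wU /=.
  by move=> <- _; exists 1; rewrite // /dilate !mul1r; case: (U).
move=> [ww' aU' pat] /andP[speeds ord].
have [s [e [f w'E]]] := wave_right_of_rarefaction U0 wU ww' speeds.
rewrite {}w'E /= in ww' ord.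
have [_ U'0] := rarefaction_gt0 aU ww'.
have [m m1 U'E] := rarefaction_dilate aU aU' U0 ww'.
have [|m' m'1 VE] := IH (Rarefaction s e f) U' aU' U'0 _ pat ord.
  by case: ww' => [[_ ->]].
exists (m' * m); first by rewrite mulr_ege1.
by rewrite VE U'E /dilate /= !mulrA.
Qed.

(** * Every pattern has the candidate profile *)

Lemma right_profile_self (U : R * R) (t x : R) :
  admissible_state U -> 0 <= t -> lam U * t <= x ->
  right_profile (lam U) U t x = U.
Proof.
move=> aU t0 xt; rewrite /right_profile ltxx.
case: ifPn => [x3|/negbTE ->//]; rewrite ray_state_self//.
rewrite lt_neqAle lambda1_ge0// andbT eq_sym; apply/negP => /eqP U0.
by move: xt x3; rewrite U0 mulr0 mul0r leNgt => /negbTE ->.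
Qed.

Lemma shock_profile {U V : R * R} {s : R} :
  admissible_state U -> admissible_state V -> is_shock alpha kappa U V s ->
  forall t x : R, 0 <= t ->
  (if x < s * t then U else V) = riemann_profile U V t x.
Proof.
move=> aU aV sh t x t0.
have [k [/andP[k0 k1] VE U0 sE]] := shock_dilate aU aV sh.
have lV : lam V = k ^+ 2 * lam U by rewrite VE lambda1_dilate.
have VU : lam V < lam U.
  by rewrite lV -[ltRHS]mul1r ltr_pM2r// expr_lt1// ltW.
have speedE : shock_speed (lam U) V = s.
  have -> : s = lam U + k * lam U + lam V by rewrite sE lV; ring.
  rewrite /shock_speed (_ : lam U * lam V = (k * lam U) ^+ 2); last first.
    by rewrite lV; ring.
  by rewrite sqrtr_sqr ger0_norm// mulr_ge0// ltW.
rewrite /riemann_profile /right_profile VU speedE.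
rewrite [X in ray_state _ X]VE ray_state_dilate// ray_state_self//.
have [xs|xs] := ltP x (s * t); first by case: ifP.
case: ltP => // xl; exfalso.
have : lam U * t <= s * t by rewrite ler_wpM2r// sE; nra.
by move=> stx; move: (le_trans stx xs); rewrite leNgt xl.
Qed.

(** One step of the induction over a chain of fans: V is an intermediate state
    on the ray of the final state W, and both fans are given by the same
    formula in terms of W. *)
Lemma rarefaction_profile {U V W : R * R} {s e m : R} {f : R -> R * R} :
  admissible_state U -> admissible_state V ->
  is_rarefaction alpha kappa U V s e f -> 1 <= m -> W = dilate m V ->
  forall t x : R, 0 <= t ->
  (if x < s * t then U
   else if x < e * t then f (x / t) else riemann_profile V W t x)
  = riemann_profile U W t x.
Proof.
move=> aU aV rar m1 WE t x t0.
have [UV V0] := rarefaction_gt0 aU rar.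
have U0 : 0 <= lam U by exact: lambda1_ge0.
have m0 : 0 < m by rewrite (lt_le_trans ltr01).
have VW : lam V <= lam W.
  by rewrite WE lambda1_dilate ler_peMl ?exprn_ege1// ltW.
have UW : (lam W < lam U) = false by apply/negbTE; rewrite -leNgt; lra.
have WV : (lam W < lam V) = false by apply/negbTE; rewrite -leNgt.
have fan := rarefaction_fan aU aV rar.
have start := rarefaction_start aU aV rar.
case: rar => [[sE eE _] _].
rewrite /riemann_profile /right_profile UW WV -[3 * lam U]sE -[3 * lam V]eE.
have rayE l : ray_state l W = ray_state l V by rewrite WE ray_state_dilate.
rewrite (rayE (lam U)) start.
have [xs|xs] := ltP x (s * t); first by case: ifP.
have sU : lam U <= s by rewrite sE /lambda2; lra.
have eV : lam V <= e by rewrite eE /lambda2; lra.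
have eW : e <= 3 * lam W by rewrite eE /lambda2; lra.
have -> : (x < lam U * t) = false.
  by apply/negbTE; rewrite -leNgt (le_trans _ xs)// ler_wpM2r.
have [xe|xe] := ltP x (e * t).
  have t1 : 0 < t.
    rewrite lt_neqAle t0 andbT; apply/eqP => tE.
    by move: (le_lt_trans xs xe); rewrite -tE !mulr0 ltxx.
  rewrite (lt_le_trans xe) ?ler_wpM2r// rayE fan//.
  by rewrite ler_pdivlMr// ler_pdivrMr// xs ltW.
by rewrite ltNge (le_trans _ xe)// ler_wpM2r.
Qed.

Lemma delta_profile (U V : R * R) (t x : R) :
  admissible_state U -> lam V = 0 -> 0 <= t ->
  (if x < lam U * t then U else V) = riemann_profile U V t x.
Proof.
move=> aU V0 t0; rewrite /riemann_profile /right_profile.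
rewrite /shock_speed V0 mulr0 sqrtr0 !addr0.
case: ltP => // xl; have U0 := lambda1_ge0 aU.
have x0 : 0 <= x by apply: le_trans xl; exact: mulr_ge0.
case: ltP => // /(conj U0)/andP/le_anti <-.
by rewrite !(mulr0, mul0r) ltNge x0.
Qed.

(** Since s = lam U, the term - s * U.2 of the growth rate cancels against the
    flux of b in U. This is why contacts of the same speed, which only change
    the state on the left of the delta shock, have no effect on the mass. *)
Lemma delta_strength {U V : R * R} {s : R} {beta : R -> R} :
  is_delta_shock alpha kappa U V s beta ->
  forall t : R, 0 <= t -> beta t = s * V.2 * t.
Proof.
move=> [_ [_ [[b0 cb db] [V0 _ sU _]]]] t t0.
have slopeE : s * (V.2 - U.2) - (flux_b alpha kappa V - flux_b alpha kappa U)
    = s * V.2 by rewrite /flux_b -V0 -sU; ring.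
have [|||c _] := @MVT_segment R beta (fun=> s * V.2) 0 t; rewrite ?b0 ?subr0//.
- by move=> y; rewrite in_itv /= => /andP[y0 _]; rewrite -slopeE; exact: db.
- apply: continuous_subspaceW cb => y /=; rewrite !in_itv /= andbT.
  by case/andP.
Qed.

(** Induction on the list of waves. A contact does not change lam U, on which
    alone the candidate depends to the right of the contact; shocks and delta
    shocks end the list; a fan is merged with the rest of the list. *)
Lemma pattern_profile {U V : R * R} {ws : seq (wave R * (R * R))} :
  admissible_state U -> wave_pattern alpha kappa U ws V -> ordered_speeds ws ->
  (forall t x : R, 0 <= t -> profile U ws t x = riemann_profile U V t x) /\
  (forall (t : R) (A : set R), 0 <= t ->
     (\sum_(p <- ws) singular_part p.1 t A
      = (delta_mass U V * t)%:E * dirac (lam U * t)%R A)%E).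
Proof.
elim: ws U => [|[w V'] ws IH] U aU /=.
  move=> <- _; split => [t x t0|t A t0].
    rewrite /riemann_profile; case: ltP => // xt.
    by rewrite right_profile_self.
  by rewrite big_nil /delta_mass; case: eqP => [->|_]; rewrite !mul0r mul0e.
move=> [ww aV' pat] ord.
have ord' : ordered_speeds ws by exact: path_sorted ord.
have [IHp IHs] := IH _ aV' pat ord'.
case: w ww ord => [s|s|s e f|s be] /= ww ord.
- case: ww => -> UV'; split => [t x t0|t A t0].
    by rewrite IHp// /riemann_profile UV'; case: ltP.
  by rewrite big_cons add0e IHs// /delta_mass UV'.
- have wsE : ws = [::].
    apply: (no_wave_right_of_fast_front aV' _ pat ord) => /=.
    by case: ww => _ _ /andP[].
  move: pat {IH IHp IHs ord ord'}; rewrite wsE /= => VE; rewrite VE in aV' ww *.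
  split=> [t x t0|t A t0]; first exact: shock_profile.
  rewrite big_cons big_nil /= add0e /delta_mass gt_eqF ?mul0r ?mul0e//.
  have [k [/andP[k0 _] -> U0 _]] := shock_dilate aU aV' ww.
  by rewrite lambda1_dilate mulr_gt0// exprn_gt0.
- have [_ V'0] := rarefaction_gt0 aU ww.
  have tailE : wave_tail (Rarefaction s e f) = lambda2 alpha kappa V'.
    by case: ww => [[]].
  have [m m1 VE] := pattern_right_of_rarefaction aV' V'0 tailE pat ord.
  split=> [t x t0|t A t0].
    by rewrite IHp//; exact: (rarefaction_profile aU aV' ww m1 VE).
  rewrite big_cons add0e IHs// /delta_mass VE lambda1_dilate.
  rewrite gt_eqF ?mul0r ?mul0e//.
  by rewrite mulr_gt0// exprn_gt0// (lt_le_trans ltr01).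
- have [_ [_ [_ [V'0 s0 sU _]]]] := ww.
  have wsE : ws = [::].
    apply: (no_wave_right_of_fast_front aV' _ pat ord) => /=.
    by rewrite /lambda2 -V'0 mulr0 V'0.
  move: pat {IH IHp IHs ord ord'}; rewrite wsE /= => VE.
  rewrite VE in V'0 s0 ww *.
  split=> [t x t0|t A t0]; first by rewrite sU; exact: delta_profile.
  rewrite big_cons big_nil /= adde0 (delta_strength ww)// /delta_mass -V'0 eqxx.
  by rewrite -sU.
Qed.

(** * Existence of a pattern *)

Lemma lambda1_ray_state (l : R) (V : R * R) :
  0 <= l -> 0 < lam V -> lam (ray_state l V) = l.
Proof.
move=> l0 V0; rewrite lambda1_dilate sqr_sqrtr ?divfK ?gt_eqF//.
by rewrite divr_ge0// ltW.
Qed.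

Lemma ray_state_admissible (l : R) (V : R * R) :
  admissible_state V -> admissible_state (ray_state l V).
Proof. by move=> aV; apply: dilate_admissible; rewrite ?sqrtr_ge0. Qed.

Lemma ray_state_shock (l : R) (V : R * R) : 0 < lam V -> lam V < l ->
  is_shock alpha kappa (ray_state l V) V (shock_speed l V).
Proof.
move=> V0 Vl; have l0 : 0 < l by lra.
have lamE := lambda1_ray_state _ _ (ltW l0) V0.
rewrite /is_shock /lambda2 /flux_h /flux_b lamE /shock_speed /=.
set k := Num.sqrt (l / lam V).
have lE : l = k ^+ 2 * lam V.
  by rewrite sqr_sqrtr ?divfK ?gt_eqF// divr_ge0// ltW.
have sqrtE : Num.sqrt (l * lam V) = k * lam V.
  rewrite (_ : l * lam V = (k * lam V) ^+ 2); last by rewrite {1}lE; ring.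
  by rewrite sqrtr_sqr ger0_norm// mulr_ge0// ?sqrtr_ge0// ltW.
have k1 : 1 < k by rewrite -sqrtr1 ltr_sqrt ?divr_gt0// ltr_pdivlMr// mul1r.
rewrite sqrtE; split.
- by rewrite lE; ring.
- by rewrite lE; ring.
- by rewrite lE; apply/andP; split; nra.
- by nra.
Qed.

Lemma ray_state_continuous (V : R * R) : continuous (ray_state ^~ V).
Proof.
pose k (l : R) := Num.sqrt (l / lam V).
have k_cont : continuous k.
  move=> l; apply: (@continuous_comp R R R (fun x => x / lam V) Num.sqrt).
    exact: mulrr_continuous.
  exact: sqrt_continuous.
move=> l; apply: (@cvg_pair _ _ _ (nbhs l) (nbhs (k l * V.1))
    (nbhs (k l * V.2)) _ _ _ (fun x => k x * V.1) (fun x => k x * V.2)).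
- by apply: cvgMr_tmp; exact: k_cont.
- by apply: cvgMr_tmp; exact: k_cont.
Qed.

Lemma ray_state_rarefaction (l : R) (V : R * R) :
  admissible_state V -> 0 <= l -> l < lam V ->
  is_rarefaction alpha kappa (ray_state l V) V (3 * l) (lambda2 alpha kappa V)
    (fun xi => ray_state (xi / 3) V).
Proof.
move=> aV l0 lV; have V0 : 0 < lam V by lra.
have xi0 xi : 3 * l <= xi -> 0 <= xi / 3 by lra.
rewrite /is_rarefaction /lambda2 lambda1_ray_state//.
split; first by split=> //; lra.
split; first split.
- by congr ray_state; field.
- by rewrite (_ : _ / 3 = lam V) ?ray_state_self//; field.
- apply: continuous_subspaceT => xi.
  apply: (@continuous_comp R R (R * R)%type (fun x => x / 3) (ray_state ^~ V)).
    exact: mulrr_continuous.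
  exact: ray_state_continuous.
split.
- by move=> xi _; exact: ray_state_admissible.
- by move=> xi /andP[/xi0 ? _]; rewrite lambda1_ray_state//; field.
- exists (V.2 / V.1) => xi _ /=.
  have h0 : V.1 != 0.
    apply: contraTneq V0 => h0.
    by rewrite /lambda1 h0 !(mulr0, mul0r, expr0n) addr0 ltxx.
  by field.
- move=> xi1 xi2 /xi0 x1 x12 _; case: aV => h0 b0.
  split=> /=; apply: ler_wpM2r => //; rewrite ler_wsqrtr//;
    by rewrite ler_pM2r ?invr_gt0//; lra.
Qed.

(** A right state with zero eigenvalue can be reached only by a contact of speed
    0 or by a delta shock, and the latter requires h = 0 there: hence the
    hypothesis on V. *)
Lemma riemann_pattern (U V : R * R) :
  admissible_state U -> admissible_state V ->
  (lam V = 0 -> lam U = 0 \/ V.1 = 0) ->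
  exists ws, wave_pattern alpha kappa U ws V /\ ordered_speeds ws.
Proof.
move=> aU aV vac.
have U0 := lambda1_ge0 aU.
have := lambda1_ge0 aV.
rewrite le_eqVlt => /predU1P[/esym V0|V0].
  have [Uz|Unz] := eqVneq (lam U) 0.
    by exists [:: (Contact 0, V)]; rewrite /= /is_contact Uz V0.
  have Up : 0 < lam U by rewrite lt_neqAle eq_sym Unz.
  have [/eqP|h0] := vac V0; first by rewrite (negbTE Unz).
  exists [:: (DeltaShock (lam U) (fun t => lam U * V.2 * t), V)].
  split => //=; split => //; split=> //.
  rewrite /flux_h /flux_b /lambda2 V0 h0; split; first by ring.
  split; last by split=> //; lra.
  split; first by rewrite mulr0.
    by apply: continuous_subspaceT => t; exact: mulrl_continuous.
  by move=> t _; apply: is_derive_eq; rewrite /GRing.scale /=; ring.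
set M := ray_state (lam U) V.
have aM : admissible_state M by exact: ray_state_admissible.
have MU : lam M = lam U by exact: lambda1_ray_state.
have [UV|VU|UV] := ltgtP (lam U) (lam V).
- exists [:: (Contact (lam U), M); (Rarefaction (3 * lam U)
    (lambda2 alpha kappa V) (fun xi => ray_state (xi / 3) V), V)].
  split=> /=; last by rewrite andbT; lra.
  split=> //; split=> //; exact: ray_state_rarefaction.
- exists [:: (Contact (lam U), M);
             (Shock (shock_speed (lam U) V), V)].
  have sh := ray_state_shock _ _ V0 VU.
  split=> /=; last by rewrite andbT ltW//; case: sh; rewrite MU.
  by split=> //; split.
- by exists [:: (Contact (lam U), V)].
Qed.

(** * The profile is a density *)

Lemma riemann_profile_ge0 (U V : R * R) (t x : R) :
  admissible_state U -> admissible_state V -> 0 <= (riemann_profile U V t x).2.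
Proof.
move=> aU aV; have ray_ge0 l : 0 <= (ray_state l V).2.
  by case: (ray_state_admissible l _ aV).
have [_ U0] := aU; have [_ V0] := aV.
by rewrite /riemann_profile /right_profile; do !case: ifP => _.
Qed.

Lemma riemann_profile_measurable (U V : R * R) (t : R) :
  measurable_fun setT (fun x => (riemann_profile U V t x).2).
Proof.
have m_if (c : R) (f g : R -> R * R) :
    measurable_fun setT (fun x => (f x).2) ->
    measurable_fun setT (fun x => (g x).2) ->
    measurable_fun setT (fun x : R => (if x < c then f x else g x).2).
  move=> mf mg; rewrite (_ : (fun x : R => _) =
      fun x => if x < c then (f x).2 else (g x).2).
    by apply: measurable_fun_ifT => //; exact: measurable_fun_ltr.
  by apply/funext => x; case: ifP.
have m_fan : measurable_fun setT (fun x : R => (ray_state (x / t / 3) V).2).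
  have m_sqrt : measurable_fun setT (@Num.sqrt R).
    by apply: continuous_measurable_fun; exact: sqrt_continuous.
  have m_scaled : measurable_fun setT (fun x : R => x / t / 3 / lam V).
    by do 3!apply: measurable_funM => //.
  by apply: measurable_funM => //; exact: (measurableT_comp m_sqrt m_scaled).
apply: (m_if) => //; rewrite /right_profile; case: (lam V < lam U).
  exact: (m_if).
by apply: (m_if) => //; exact: (m_if).
Qed.

End RiemannProblem.

Theorem theorem1p3 (R : realType) (alpha kappa hm bm hp bp : R)
    (alpha_ge0 : 0 <= alpha) (kappa_ge0 : 0 <= kappa)
    (Um_in : admissible_state (hm, bm)) (Up_in : admissible_state (hp, bp))
    (at_most_one_zero : (count (pred1 0%R) [:: hm; hp; bm; bp] <= 1)%N)
    (nondegenerate : ~ (kappa = 0 /\ 0 < alpha /\ bp = 0)) :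
  exists (h : R -> R -> R)
         (b : R -> {measure set (measurableTypeR R) -> \bar R}),
    riemann_solution alpha kappa (hm, bm) (hp, bp) h b /\
    (forall (h' : R -> R -> R)
            (b' : R -> {measure set (measurableTypeR R) -> \bar R}),
       riemann_solution alpha kappa (hm, bm) (hp, bp) h' b' ->
       same_solution h b h' b').
Proof.
set U := (hm, bm) in Um_in *; set V := (hp, bp) in Up_in *.
pose P := riemann_profile alpha kappa U V.
pose m := delta_mass alpha kappa U V.
pose s := lambda1 alpha kappa U.
have [ws [pat ord]] :
    exists ws, wave_pattern alpha kappa U ws V /\ ordered_speeds ws.
  apply: riemann_pattern => // lamV0.
  have [hp0|hp0] := eqVneq hp 0; [by right|left].
  have [//|k0 [a0|bp0]] := lambda1_eq0 _ _ alpha_ge0 kappa_ge0 Up_in _ lamV0.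
    by rewrite /lambda1 k0 a0 !mul0r addr0.
  have := alpha_ge0; rewrite le_eqVlt => /predU1P[a0|a_gt0].
    by rewrite /lambda1 k0 -a0 !mul0r addr0.
  by case: nondegenerate.
have profE := pattern_profile _ _ alpha_ge0 kappa_ge0 Um_in.
have m0 : 0 <= m.
  rewrite /m /delta_mass; case: ifP => // _; apply: mulr_ge0.
    exact: lambda1_ge0.
  by case: Up_in.
have [b bE] : {b : R -> {measure set (measurableTypeR R) -> \bar R} |
    forall t, 0 <= t -> forall A : set R, measurable A -> b t A =
    (\int[@lebesgue_measure R]_(x in A) (P t x).2%:E
     + (m * t)%:E * dirac (s * t)%R A)%E}.
  suff /choice[b bE] : forall t : R,
    exists mu : {measure set (measurableTypeR R) -> \bar R},
    0 <= t -> forall A : set R, measurable A -> mu A =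
    (\int[@lebesgue_measure R]_(x in A) (P t x).2%:E
     + (m * t)%:E * dirac (s * t)%R A)%E by exists b.
  move=> t.
  have [mu muE] := density_measure (@lebesgue_measure R)
    (riemann_profile_measurable alpha kappa U V t)
    (fun x => riemann_profile_ge0 alpha kappa U V t x Um_in Up_in).
  (* No condition bears on b t for t < 0: any measure will do. *)
  have [t0|t0] := leP 0 t; last by exists mu.
  pose delta : {measure set (measurableTypeR R) -> \bar R} :=
    mscale (NngNum (mulr_ge0 m0 t0)) (dirac (s * t : measurableTypeR R)).
  exists (measure_add mu delta).
  move=> _ A mA; apply: (eq_trans (measure_addE mu delta A)).
  by rewrite muE.
exists (fun t x => (P t x).1), b; split.
  have [wsP wsS] := profE _ _ pat ord.
  exists ws; split=> // t t0.
    by apply: aeW => x; rewrite wsP.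
  move=> A mA; rewrite bE// wsS//.
  by congr (_ + _)%E; apply: eq_integral => x _; rewrite wsP.
move=> h' b' [ws' [pat' ord' hE' bE']] t t0.
have [wsP wsS] := profE _ _ pat' ord'.
split.
  have [N [mN N0 hN]] := hE' t t0; exists N; split=> //.
  by apply: subset_trans hN => x /= neq hx; apply: neq; rewrite hx wsP.
move=> A mA; rewrite bE// bE'// wsS//.
by congr (_ + _)%E; apply: eq_integral => x _; rewrite wsP.
Qed.
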